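(* Let $\lambda,\mu>0$, let $T:\mathcal H\to\mathcal H$ be $\lambda$-RFNE and $U:\mathcal H\to\mathcal H$ be $\mu$-RFNE. Then: (i) For all $x,y\in\mathcal H$ and all $\nu\in\mathbb R\setminus\{0\}$, writing $a_1:=T(x)-x$, $a_2:=T(y)-y$, $b_1:=UT(x)-T(x)$, $b_2:=UT(y)-T(y)$, $$\langle y-x,(UT(x)-x)-(UT(y)-y)\rangle-\tfrac1\nu\|(UT(x)-x)-(UT(y)-y)\|^2$$ $$\ge\left(\tfrac1\lambda-\tfrac1\nu\right)\|a_1-a_2\|^2+\left(\tfrac1\mu-\tfrac1\nu\right)\|b_1-b_2\|^2+\left(1-\tfrac2\nu\right)\langle a_1-a_2,b_1-b_2\rangle.$$ (ii) If $\lambda\mu<4$, then $UT$ is $\nu^*$-RFNE, where $\nu^*:=\frac{4(\lambda+\mu-\lambda\mu)}{4-\lambda\mu}$. Consequently, $UT$ satisfies the demi closedness principle. Moreover, if $\dim\mathcal H\ge2$, then the constant $\nu^*$ is optimal, i.e. for arbitrary $\rho\in(0,\nu^* )$ there are a $\lambda$-RFNE operator $T:\mathcal H\to\mathcal H$ and a $\mu$-RFNE operator $U:\mathcal H\to\mathcal H$ such that $UT$ is not $\rho$-RFNE. (iii) If $\lambda\mu<\lambda+\mu$ and $\operatorname{Fix}T\cap\operatorname{Fix}U\ne\emptyset$, then $\operatorname{Fix}UT=\operatorname{Fix}T\cap\operatorname{Fix}U$. (iv) Suppose that $\lambda\mu>4$. If $\lambda\mu\le\lambda+\mu$ and $\dim\mathcal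 H\ge2$, or if $\lambda\mu>\lambda+\mu$, then there are a $\lambda$-RFNE operator $T:\mathcal H\to\mathcal H$ and a $\mu$-RFNE operator $U:\mathcal H\to\mathcal H$ such that $UT$ is not RFNE. (v) If $\lambda\mu\ge\lambda+\mu$, then there are a $\lambda$-RFNE operator $T:\mathcal H\to\mathcal H$ and a $\mu$-RFNE operator $U:\mathcal H\to\mathcal H$ such that $\operatorname{Fix}UT\ne\operatorname{Fix}T\cap\operatorname{Fix}U\ne\emptyset$.
   Context: $\mathcal H$ is a real Hilbert space with $\mathcal H\neq\{0\}$; $UT$ denotes the composition $U\circ T$; $\operatorname{Fix}T:=\{z\in\mathcal H:T(z)=z\}$. An operator $S:\mathcal H\to\mathcal H$ is firmly nonexpansive (FNE) if $\langle S(x)-S(y),x-y\rangle\ge\|S(x)-S(y)\|^2$ for all $x,y\in\mathcal H$. For $\lambda>0$, the $\lambda$-relaxation of $S$ is $S_\lambda:=\operatorname{Id}+\lambda(S-\operatorname{Id})$. An operator $T$ is $\lambda$-relaxed firmly nonexpansive ($\lambda$-RFNE) if $T$ is the $\lambda$-relaxation of some FNE operator; it is RFNE if it is $\lambda$-RFNE for some $\lambda>0$. An operator $T$ satisfies the demi closedness principle if for any bounded sequence $\{x^k\}$ with $\|T(x^k)-x^k\|\to0$, every weak cluster point of $\{x^k\}$ belongs to $\operatorname{Fix}T$. *)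

(* Defs.v *)
From HB Require Import structures.
From mathcomp Require Import all_boot all_order all_algebra.
From mathcomp Require Import all_classical all_reals all_analysis.
Import Order.TTheory GRing.Theory Num.Theory numFieldNormedType.Exports.

Set Implicit Arguments.
Unset Strict Implicit.
Unset Printing Implicit Defensive.

Local Open Scope classical_set_scope.
Local Open Scope ring_scope.

(* A Hilbert space is a complete normed module H together with a positive
   definite symmetric bilinear form ip inducing its norm. *)
Definition induces_norm (R : realType) (H : normedModType R)
    (ip : {dot H for idfun}) : Prop :=
  forall x : H, `|x| ^+ 2 = ip x x.

(* dim V >= n, with V possibly infinite-dimensional. *)
Definition dim_ge (R : realType) (V : lmodType R) (n : nat) : Prop :=
  exists v : 'I_n -> V, forall c : 'I_n -> R,
    \sum_(i < n) c i *: v i = 0 -> forall i, c i = 0.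

Definition Fix (X : Type) (T : X -> X) : set X := [set z | T z = z].

Definition firmly_nonexpansive (R : realType) (H : normedModType R)
    (ip : {dot H for idfun}) (S : H -> H) : Prop :=
  forall x y : H, `|S x - S y| ^+ 2 <= ip (S x - S y) (x - y).

Definition relaxation (R : realType) (H : normedModType R) (lambda : R)
    (S : H -> H) : H -> H :=
  fun x => x + lambda *: (S x - x).

Definition relaxed_FNE (R : realType) (H : normedModType R)
    (ip : {dot H for idfun}) (lambda : R) (T : H -> H) : Prop :=
  0 < lambda /\
  exists2 S : H -> H, firmly_nonexpansive ip S & T = relaxation lambda S.

Definition RFNE (R : realType) (H : normedModType R)
    (ip : {dot H for idfun}) (T : H -> H) : Prop :=
  exists lambda : R, relaxed_FNE ip lambda T.

(* The weak topology of a Hilbert space, i.e. the coarsest topology making all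
   the maps ip ^~ y continuous; by Riesz these are all the continuous linear
   functionals. *)
Definition weak_space (R : realType) (H : normedModType R)
    (ip : {dot H for idfun}) : topologicalType :=
  initial_topology ((fun x y => ip x y) : H -> {ptws H -> R}).

Definition weak_cluster_point (R : realType) (H : normedModType R)
    (ip : {dot H for idfun}) (x : nat -> H) (p : H) : Prop :=
  cluster ((x : nat -> weak_space ip) @ \oo) (p : weak_space ip).

Definition demi_closedness_principle (R : realType) (H : normedModType R)
    (ip : {dot H for idfun}) (T : H -> H) : Prop :=
  forall x : nat -> H,
    bounded_fun x ->
    (fun k => `|T (x k) - x k|) @ \oo --> (0 : R) ->
    forall p : H, weak_cluster_point ip x p -> Fix T p.

(* Main.v *)
Require Import Defs.
From mathcomp Require Import all_boot all_order all_algebra.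
From mathcomp Require Import all_classical all_reals all_analysis.
From mathcomp Require Import ring lra.
Import Order.TTheory GRing.Theory Num.Theory numFieldNormedType.Exports.

Local Open Scope classical_set_scope.
Local Open Scope ring_scope.

(** Everything is read off the residuals [T x - x].  An operator is
    [lambda]-relaxed firmly nonexpansive exactly when the difference [a] of its
    residuals at [x] and [y] satisfies
    [|a| ^ 2 / lambda <= <y - x, a>] ([relaxed_FNEP]).  Adding this inequality
    for [T] at [x, y] to the one for [U] at [T x, T y], where
    [T y - T x = (y - x) - a], gives for the residual [a + b] of [U T]
    [|a| ^ 2 / lambda + |b| ^ 2 / mu + <a, b> <= <y - x, a + b>]
    ([residual_comp_ge]); part (i) is this inequality with
    [|a + b| ^ 2 / nu] subtracted from both sides.

    The positive statements are specializations.  For [nu = nu_star] the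
    quadratic form in [a, b] in part (i) is a perfect square, whence the
    relaxation parameter of [U T] ([relaxed_FNE_comp]); when the residual of
    [U T] vanishes, [b = - a] and the inequality forces [a = 0] if
    [1 / lambda + 1 / mu > 1] ([Fix_comp]).  Demi closedness holds for every
    relaxed firmly nonexpansive operator, by comparing the sequence with its
    weak cluster point in the residual inequality
    ([relaxed_FNE_demiclosed]).

    The counterexamples are linear.  In a plane seen as the complex numbers,
    multiplication by [1 - 1 / u] has residual [- z / u] and is
    [lambda]-relaxed firmly nonexpansive, with equality in the residual
    inequality, when [Re u = 1 / lambda].  Composing the factors given by [u]
    and [v] yields [1 - (u + v - 1) / (u v)], so the composition is governed
    by the values of [Re (u v / (u + v - 1))] as [u] and [v] run over two
    vertical lines.  Their infimum is [1 / nu_star] when [lambda * mu < 4] and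
    is only approached at infinity, whence optimality for [rho < nu_star].
    When [lambda * mu > 4] the relevant quadratic form is indefinite and
    negative values occur.  If [1 / lambda + 1 / mu <= 1], homotheties with
    negative ratios do, and these exist on a line. *)

(** * Relaxation parameters *)

(** By the AM-GM inequality, [lambda * mu <= ((lambda + mu) / 2) ^ 2]. *)
Lemma relaxation_gap_gt0 {R : realType} {lambda mu : R} :
  0 < lambda -> 0 < mu -> lambda * mu < 4 -> 0 < lambda + mu - lambda * mu.
Proof.
move=> lambda0 mu0 lm4.
have amgm : 4 * (lambda * mu) <= (lambda + mu) ^+ 2.
  by have := sqr_ge0 (lambda - mu); lra.
have : (lambda * mu) ^+ 2 < (lambda + mu) ^+ 2.
  by apply: lt_le_trans amgm; rewrite expr2 ltr_pM2r// mulr_gt0.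
by rewrite subr_gt0 ltr_pXn2r ?nnegrE ?addr_ge0 ?mulr_ge0 ?ltW.
Qed.

Lemma invrD_sub1E {R : realType} {lambda mu : R} : 0 < lambda -> 0 < mu ->
  lambda^-1 + mu^-1 - 1 = (lambda + mu - lambda * mu) / (lambda * mu).
Proof.
by move=> lambda0 mu0; field; rewrite (gt_eqF lambda0) (gt_eqF mu0).
Qed.

(** * Inner products *)

Section InnerProduct.
Context {R : realType} {H : normedModType R} {ip : {dot H for idfun}}.
Hypothesis ip_norm : induces_norm ip.
Implicit Types (x y z : H) (c t : R).

Lemma ipC x y : ip x y = ip y x.
Proof. by have := hermC ip x y; rewrite expr0 mul1r. Qed.

Lemma ipDl x y z : ip (x + y) z = ip x z + ip y z.
Proof. exact: linearDl. Qed.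

Lemma ipNl x z : ip (- x) z = - ip x z.
Proof. exact: linearNl. Qed.

Lemma ipZl c x z : ip (c *: x) z = c * ip x z.
Proof. exact: linearZl_LR. Qed.

Lemma ipDr x y z : ip z (x + y) = ip z x + ip z y.
Proof. by rewrite ipC ipDl !(ipC z). Qed.

Lemma ipNr x z : ip z (- x) = - ip z x.
Proof. by rewrite ipC ipNl (ipC z). Qed.

Lemma ipZr c x z : ip z (c *: x) = c * ip z x.
Proof. by rewrite ipC ipZl (ipC z). Qed.

Definition ipE := (ipDl, ipDr, ipNl, ipNr, ipZl, ipZr).

Lemma ip_ge0 x : 0 <= ip x x.
Proof. by rewrite -ip_norm sqr_ge0. Qed.

(** The Cauchy-Schwarz inequality, from the norm of [|y| x - |x| y]. *)
Lemma ip_le_norm x y : ip x y <= `|x| * `|y|.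
Proof.
have [->|x0] := eqVneq x 0; first by rewrite (linear0l ip) normr0 mul0r.
have [->|y0] := eqVneq y 0; first by rewrite (linear0r ip) normr0 mulr0.
have px : 0 < `|x| by rewrite normr_gt0.
have py : 0 < `|y| by rewrite normr_gt0.
have := ip_ge0 (`|y| *: x - `|x| *: y); rewrite !ipE -!ip_norm (ipC y x).
set u := `|x|; set v := `|y|; set c := ip x y => h.
have h2 : 0 <= (u * v) * (u * v - c) by lra.
by move: h2; rewrite pmulr_rge0 ?mulr_gt0// subr_ge0.
Qed.

Lemma orthonormal_pair : dim_ge H 2 ->
  exists e1 e2 : H, [/\ ip e1 e1 = 1, ip e2 e2 = 1 & ip e1 e2 = 0].
Proof.
have unit_vec v : v != 0 -> ip (`|v|^-1 *: v) (`|v|^-1 *: v) = 1.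
  move=> v0; rewrite ipZl ipZr -ip_norm; have : `|v| != 0 by rewrite normr_eq0.
  by move=> h; field.
move=> [v v_free].
have indep (a b : R) : a *: v ord0 + b *: v ord_max = 0 -> a = 0 /\ b = 0.
  move=> ab0; pose f (i : 'I_2) := if i == ord0 then a else b.
  have /v_free f0 : \sum_(i < 2) f i *: v i = 0.
    rewrite big_ord_recr big_ord1 /= -ab0; congr (_ *: v _ + _).
    exact: val_inj.
  by split; [exact: (f0 ord0)|exact: (f0 ord_max)].
pose e1 := `|v ord0|^-1 *: v ord0.
have v0 : v ord0 != 0.
  apply/eqP => v00; have [] := indep 1 0; last by move/eqP; rewrite oner_eq0.
  by rewrite v00 scaler0 scale0r addr0.
have e11 : ip e1 e1 = 1 by exact: unit_vec.
pose w := v ord_max - ip (v ord_max) e1 *: e1.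
have w0 : w != 0.
  apply/eqP => w0; have [] := indep (- (ip (v ord_max) e1 / `|v ord0|)) 1.
    by rewrite scale1r scaleNr addrC -scalerA; exact: w0.
  by move=> _ /eqP; rewrite oner_eq0.
exists e1, (`|w|^-1 *: w); split=> //; first exact: unit_vec.
by rewrite ipZr ipDr ipNr ipZr e11 mulr1 ipC subrr mulr0.
Qed.

(** * The residual inequality and compositions *)

(** With [T = Id + lambda g] and [S = Id + g], expanding
    [|S x - S y| ^ 2 <= <S x - S y, x - y>] gives
    [|u| ^ 2 <= <y - x, u>] for [u = g x - g y], and [lambda *: u] is the
    difference of the residuals of [T]. *)
Lemma relaxed_FNEP {lambda} {T : H -> H} : 0 < lambda ->
  relaxed_FNE ip lambda T <->
  (forall x y, lambda^-1 * `|(T x - x) - (T y - y)| ^+ 2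
               <= ip (y - x) ((T x - x) - (T y - y))).
Proof.
move=> l0; have ln0 : lambda != 0 by rewrite gt_eqF.
have red (g : H -> H) x y :
    (`|(x + g x) - (y + g y)| ^+ 2 <= ip ((x + g x) - (y + g y)) (x - y))
    = (lambda^-1 * `|lambda *: g x - lambda *: g y| ^+ 2
       <= ip (y - x) (lambda *: g x - lambda *: g y)).
  have -> : (x + g x) - (y + g y) = (x - y) + (g x - g y).
    by rewrite opprD addrACA.
  rewrite -scalerBr -(opprB x y).
  move: (x - y) (g x - g y) => w u; rewrite !ip_norm !ipE (ipC u w).
  rewrite -[LHS]subr_ge0 -[RHS]subr_ge0.
  have -> : - (lambda * ip w u) - lambda^-1 * (lambda * (lambda * ip u u))
     = lambda * (- ip w u - ip u u) by field.
  by rewrite (pmulr_rge0 _ l0); congr (0 <= _); ring.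
split=> [[_ [S S_fne ->]] x y|T_le].
  have e z : relaxation lambda S z - z = lambda *: (S z - z).
    by rewrite /relaxation addrAC subrr add0r.
  have := red (fun z => S z - z) x y; rewrite /= -!e => <-.
  by rewrite !(addrC _ (S _ - _)) !subrK; exact: S_fne.
split=> //; exists (relaxation lambda^-1 T) => [x y|].
  have := red (fun z => lambda^-1 *: (T z - z)) x y.
  by rewrite /= !scalerA divff// !scale1r /relaxation => ->.
apply/funext => x; rewrite /relaxation addrAC subrr add0r scalerA divff//.
by rewrite scale1r addrC subrK.
Qed.

(** The sum of the residual inequalities of [T] at [x, y] and of [U] at
    [T x, T y]; the term [ip a b] comes from [T y - T x = (y - x) - a]. *)
Lemma residual_comp_ge {lambda mu} {T U : H -> H} :
  relaxed_FNE ip lambda T -> relaxed_FNE ip mu U ->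
  forall x y a b,
  a = (T x - x) - (T y - y) ->
  b = (U (T x) - T x) - (U (T y) - T y) ->
  lambda^-1 * `|a| ^+ 2 + mu^-1 * `|b| ^+ 2 + ip a b <= ip (y - x) (a + b).
Proof.
move=> TF UF x y a b aE bE.
have [l0 _] := TF; have [m0 _] := UF.
have := (relaxed_FNEP l0).1 TF x y.
have := (relaxed_FNEP m0).1 UF (T x) (T y).
rewrite -aE -bE.
set na := `|a| ^+ 2; set nb := `|b| ^+ 2.
rewrite !(ipDl, ipNl, ipDr a) {}[in ip a b]aE !(ipDl, ipNl).
lra.
Qed.

(** The residual of the composition is [d = a + b].  Subtracting [r * |d| ^ 2]
    makes the right-hand side the quantity whose nonnegativity for all [x, y]
    says that [U \o T] is relaxed firmly nonexpansive with parameter [r^-1]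
    when [r > 0]. *)
Lemma relaxed_residual_comp_ge {lambda mu} {T U : H -> H} (r : R) :
  relaxed_FNE ip lambda T -> relaxed_FNE ip mu U ->
  forall x y a b d,
  a = (T x - x) - (T y - y) ->
  b = (U (T x) - T x) - (U (T y) - T y) ->
  d = (U (T x) - x) - (U (T y) - y) ->
  (lambda^-1 - r) * `|a| ^+ 2 + (mu^-1 - r) * `|b| ^+ 2 + (1 - 2 * r) * ip a b
  <= ip (y - x) d - r * `|d| ^+ 2.
Proof.
move=> TF UF x y a b d aE bE dE.
have -> : d = a + b.
  rewrite dE aE bE addrACA -opprD.
  by rewrite ![T _ - _ + _]addrC !addrA !subrK.
have := residual_comp_ge TF UF x y a b aE bE.
rewrite [`|a + b| ^+ 2]ip_norm [ip (a + b) _]ipDl !(ipDr a b) (ipC b a).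
rewrite -!ip_norm.
lra.
Qed.

(** At a fixed point [x] of the composition the residual [b] of [U] is opposite
    to the residual [a] of [T], so that against a common fixed point the
    inequality reads [(lambda^-1 + mu^-1 - 1) * |a| ^ 2 <= 0]. *)
Lemma Fix_comp {lambda mu : R} {T U : H -> H} :
  relaxed_FNE ip lambda T -> relaxed_FNE ip mu U ->
  lambda * mu < lambda + mu -> Fix T `&` Fix U !=set0 ->
  Fix (U \o T) = Fix T `&` Fix U.
Proof.
move=> TF UF lm [z [Tz Uz]]; have [lambda0 _] := TF; have [mu0 _] := UF.
apply/seteqP; split=> x; last by move=> [Tx Ux]; rewrite /Fix /= Tx.
rewrite /Fix /= => UTx.
have := residual_comp_ge TF UF x z (T x - x) (- (T x - x)).
rewrite !Tz !Uz UTx !subrr !subr0 opprB => /(_ erefl erefl).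
rewrite -opprB normrN ipNr -ip_norm (linear0r ip) => h.
have c0 : 0 < lambda^-1 + mu^-1 - 1.
  by rewrite invrD_sub1E// divr_gt0 ?mulr_gt0// subr_gt0.
have : (lambda^-1 + mu^-1 - 1) * `|T x - x| ^+ 2 <= 0 by lra.
rewrite pmulr_rle0// => Tx_le0.
have Tx : T x = x.
  by apply/eqP; rewrite -subr_eq0 -normr_eq0 -sqrf_eq0 eq_le Tx_le0 sqr_ge0.
by split=> //; rewrite -{1}Tx.
Qed.

(** When [r] is the inverse of this parameter, the quadratic form in [a, b] on
    the left of [relaxed_residual_comp_ge] is a positive multiple of the square
    of [mu (2 - lambda) a - lambda (2 - mu) b], hence nonnegative. *)
Lemma relaxed_FNE_comp {lambda mu : R} {T U : H -> H} :
  relaxed_FNE ip lambda T -> relaxed_FNE ip mu U -> lambda * mu < 4 ->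
  relaxed_FNE ip (4 * (lambda + mu - lambda * mu) / (4 - lambda * mu)) (U \o T).
Proof.
move=> TF UF lm4; have [lambda0 _] := TF; have [mu0 _] := UF.
have D0 := relaxation_gap_gt0 lambda0 mu0 lm4.
have E0 : 0 < 4 - lambda * mu by rewrite subr_gt0.
set nu := _ / _.
have nu0 : 0 < nu by rewrite divr_gt0 ?mulr_gt0.
apply/relaxed_FNEP => // x y; rewrite -subr_ge0.
apply: le_trans
  (relaxed_residual_comp_ge nu^-1 TF UF x y _ _ _ erefl erefl erefl).
move: (T x - x - _) (_ - T x - _) => a b.
have -> : (lambda^-1 - nu^-1) * `|a| ^+ 2 + (mu^-1 - nu^-1) * `|b| ^+ 2
    + (1 - 2 * nu^-1) * ip a b
  = (4 * (lambda + mu - lambda * mu) * lambda * mu)^-1 *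
    `|(mu * (2 - lambda)) *: a - (lambda * (2 - mu)) *: b| ^+ 2.
  rewrite !ip_norm !ipE (ipC b a) /nu; field.
  rewrite (gt_eqF lambda0) (gt_eqF mu0) (gt_eqF E0) /= andbT.
  by apply: lt0r_neq0; lra.
by rewrite mulr_ge0 ?sqr_ge0// invr_ge0 !mulr_ge0// ltW.
Qed.

(** * Demi closedness *)

Lemma continuous_ip_weak (e : H) :
  continuous ((fun z => ip z e) : weak_space ip -> R).
Proof.
pose f : weak_space ip -> {ptws H -> R} := fun x y => ip x y.
have cf : continuous f by exact: initial_continuous.
have cp : continuous (proj e : {ptws H -> R} -> R) by exact: proj_continuous.
by move=> z; apply: (@continuous_comp _ _ _ f _ z (cf z) (cp (f z))).
Qed.

(** In the residual inequality between [x k] and [p] the term [<p - x k, d_k>],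
    with [d_k] the residual of [x k], tends to [0] by boundedness, and
    [<p - x k, e>], with [e] the residual of [p], is small infinitely often by
    weak clustering; so [|e| ^ 2 / nu <= 0] in the limit. *)
Lemma relaxed_FNE_demiclosed {nu} {T : H -> H} :
  relaxed_FNE ip nu T -> demi_closedness_principle ip T.
Proof.
move=> TF x xbd Tx0 p xp; have [nu0 _] := TF.
set e := T p - p.
suff e0 : e = 0 by apply/eqP; rewrite -subr_eq0 -/e e0.
apply/eqP; apply: contraT => en0.
have e_gt0 : 0 < `|e| by rewrite normr_gt0.
have [M M0 xM] := ex_strict_bound_gt0 xbd.
pose C := `|p| + M.
have C0 : 0 < C by rewrite ltr_wpDl.
(* Half of the lower bound [nu^-1 * (|e| / 2) ^ 2] available on the left of
   the residual inequality as soon as [d_k], the residual of [x k], has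
   norm less than [|e| / 2]. *)
pose delta := nu^-1 * `|e| ^+ 2 / 8.
have d0 : 0 < delta by rewrite divr_gt0// mulr_gt0 ?invr_gt0// exprn_gt0.
have small eps : 0 < eps -> \forall k \near \oo, `|T (x k) - x k| < eps.
  move=> eps0; have /(_ _) := cvgr0_norm_lt _ Tx0 _ eps0.
  by apply: filterS => k /=; rewrite normr_id.
have nbhs_p : nbhs (p : weak_space ip) [set z : H | `|ip p e - ip z e| < delta].
  have := continuous_ip_weak e (p : weak_space ip).
  by move=> /cvgrPdist_lt/(_ _ d0).
have evx : \forall k \near \oo,
    `|T (x k) - x k| < `|e| / 2 /\ C * `|T (x k) - x k| < delta.
  near=> k; split; first by near: k; apply: small; rewrite divr_gt0.
  rewrite mulrC -ltr_pdivlMr//.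
  by near: k; apply: small; rewrite divr_gt0.
have [z [[k [dk1 dk2] E] zk]] :
    (x @` [set k | `|T (x k) - x k| < `|e| / 2 /\ C * `|T (x k) - x k| < delta])
    `&` [set z : H | `|ip p e - ip z e| < delta] !=set0.
  apply: xp nbhs_p.
  by apply: filterS evx => k hk; exists k.
move: zk; rewrite -{}E /= => zk.
have := (relaxed_FNEP nu0).1 TF (x k) p; rewrite -/e.
set d := T (x k) - x k in dk1 dk2 *.
have lower : `|e| ^+ 2 / 4 <= `|d - e| ^+ 2.
  have h : `|e| / 2 <= `|d - e|.
    by have := ler_normB d (d - e); rewrite subKr; lra.
  have -> : `|e| ^+ 2 / 4 = (`|e| / 2) ^+ 2 by field.
  by rewrite lerXn2r ?nnegrE ?divr_ge0.
have up : ip (p - x k) d < delta.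
  apply: le_lt_trans dk2; apply: le_trans (ip_le_norm _ _) _.
  rewrite ler_wpM2r//; apply: le_trans (ler_normB _ _) _.
  by rewrite lerD2l ltW//; exact: (xM k I).
have [zk1 zk2] : - delta < ip p e - ip (x k) e /\ ip p e - ip (x k) e < delta.
  by move: zk; rewrite ltr_norml => /andP[].
have nlow : nu^-1 * (`|e| ^+ 2 / 4) <= nu^-1 * `|d - e| ^+ 2.
  by rewrite ler_pM2l// invr_gt0.
clearbody d e; rewrite /delta in zk1 zk2 *; move: up; rewrite /delta !ipE.
lra.
Unshelve. all: by end_near.
Qed.

(** * Linear examples *)

Lemma homothety_relaxed_FNE {lambda t} :
  0 < lambda -> 0 <= t <= lambda ->
  relaxed_FNE ip lambda (fun x => (1 - t) *: x).
Proof.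
move=> l0 /andP[t0 tl]; apply/relaxed_FNEP => // x y.
have -> : (1 - t) *: x - x - ((1 - t) *: y - y) = t *: (y - x).
  rewrite !scalerBl !scale1r scalerBr.
  by rewrite [x - _ - x]addrAC [y - _ - y]addrAC !subrr !add0r opprK addrC.
rewrite normrZ exprMn ip_norm ipZr real_normK ?num_real// mulrA.
rewrite ler_wpM2r ?ip_ge0// expr2 mulrA ler_piMl//.
by rewrite mulrC ler_pdivrMr// mul1r.
Qed.

(** Identifying the plane spanned by [e1] and [e2] with the complex numbers,
    this is multiplication by [1 - 1 / (l + i s)] there, and the identity on
    the orthogonal complement.  When [s] runs over the reals these factors fill
    the circle, except [1], of centre [1 - 1 / (2 l)] through [1]. *)
Definition plane_op (e1 e2 : H) (l s : R) (x : H) : H :=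
  let n := l ^+ 2 + s ^+ 2 in
  x - (((l * ip x e1 + s * ip x e2) / n) *: e1
       + ((l * ip x e2 - s * ip x e1) / n) *: e2).

Section Plane.
Context {e1 e2 : H}.
Hypotheses (e11 : ip e1 e1 = 1) (e22 : ip e2 e2 = 1) (e12 : ip e1 e2 = 0).

Lemma ip_plane (p q p' q' : R) :
  ip (p *: e1 + q *: e2) (p' *: e1 + q' *: e2) = p * p' + q * q'.
Proof. by rewrite !ipE (ipC e2 e1) e11 e22 e12; ring. Qed.

(** The residual is [- z / u] with [Re u = lambda^-1], so that the residual
    inequality is an equality. *)
Lemma plane_op_relaxed_FNE {lambda s} :
  0 < lambda -> relaxed_FNE ip lambda (plane_op e1 e2 lambda^-1 s).
Proof.
move=> l0; apply/relaxed_FNEP => // x y.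
have k0 : 0 < lambda^-1 by rewrite invr_gt0.
set k := lambda^-1 in k0 *.
have n0 : k ^+ 2 + s ^+ 2 != 0.
  by rewrite gt_eqF// ltr_wpDr ?sqr_ge0// exprn_gt0.
pose p := ip (y - x) e1; pose q := ip (y - x) e2.
have -> : plane_op e1 e2 k s x - x - (plane_op e1 e2 k s y - y) =
    ((k * p + s * q) / (k ^+ 2 + s ^+ 2)) *: e1 +
    ((k * q - s * p) / (k ^+ 2 + s ^+ 2)) *: e2.
  rewrite /plane_op [x - _ - x]addrAC [y - _ - y]addrAC !subrr !add0r opprK addrC.
  rewrite opprD addrACA -!(scalerBl _ _ e1) -!(scalerBl _ _ e2) /p /q !ipE.
  by congr (_ *: _ + _ *: _); field.
rewrite ip_norm ip_plane ipDr !ipZr -/p -/q.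
rewrite le_eqVlt; apply/orP; left; apply/eqP.
by field.
Qed.

(** With [u = l + i s] and [v = k + i t] the composition multiplies the plane by
    [1 - (u + v - 1) / (u v)].  The inequality is the residual inequality
    between the points [u v] and [0], where no denominator is left. *)
Lemma plane_op_comp_ineq {l k s t rho : R} : 0 < l -> 0 < k ->
  relaxed_FNE ip rho (plane_op e1 e2 k t \o plane_op e1 e2 l s) ->
  rho^-1 * ((l + k - 1) ^+ 2 + (s + t) ^+ 2)
    <= (l + k - 1) * (l * k - s * t) + (s + t) * (l * t + k * s).
Proof.
move=> l0 k0 /[dup] [[rho0 _]] /(relaxed_FNEP rho0).
(* [w] is [u v] for [u = l + i s], [v = k + i t]; the inner operator sends it
   to [u v - v] and the outer one then to [u v - v - (u - 1)]. *)
pose w : H := (l * k - s * t) *: e1 + (l * t + k * s) *: e2.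
move=> /(_ w 0).
have nl : l ^+ 2 + s ^+ 2 != 0.
  by rewrite gt_eqF// ltr_wpDr ?sqr_ge0// exprn_gt0.
have nk : k ^+ 2 + t ^+ 2 != 0.
  by rewrite gt_eqF// ltr_wpDr ?sqr_ge0// exprn_gt0.
have opE (a b p q : R) : plane_op e1 e2 a b (p *: e1 + q *: e2) =
    (p - (a * p + b * q) / (a ^+ 2 + b ^+ 2)) *: e1 +
    (q - (a * q - b * p) / (a ^+ 2 + b ^+ 2)) *: e2.
  rewrite /plane_op !ipE (ipC e2 e1) e11 e22 e12.
  rewrite !(mulr0, mulr1, addr0, add0r) opprD addrACA.
  by rewrite -!(scalerBl _ _ e1) -!(scalerBl _ _ e2).
have op0 a b : plane_op e1 e2 a b 0 = 0.
  by have := opE a b 0 0; rewrite !(scale0r, mulr0, addr0, subr0, mul0r).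
have -> : (plane_op e1 e2 k t \o plane_op e1 e2 l s) w - w =
    - (l + k - 1) *: e1 + - (s + t) *: e2.
  rewrite /= /w !opE opprD addrACA -!(scalerBl _ _ e1) -!(scalerBl _ _ e2).
  by congr (_ *: _ + _ *: _); field; rewrite nl nk.
rewrite /= !op0 !subr0 sub0r ip_norm ipNl !ip_plane.
have -> : - (l + k - 1) * - (l + k - 1) + - (s + t) * - (s + t) =
   (l + k - 1) ^+ 2 + (s + t) ^+ 2 by ring.
move/le_trans; apply; rewrite le_eqVlt; apply/orP; left; apply/eqP.
by ring.
Qed.
End Plane.

(** For [s + t] fixed, the quotient of the right-hand side of
    [plane_op_comp_ineq] by the factor of [rho^-1] on its left is least at
    [s = K (2 l - 1)], [t = K (2 k - 1)].  As [K] grows it decreases to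
    [(4 l k - 1) / (4 (l + k - 1))], the inverse of the upper bound on [rho],
    and so becomes smaller than [rho^-1]. *)
Lemma relaxed_FNE_comp_optimal {lambda mu rho : R} :
  0 < lambda -> 0 < mu -> lambda * mu < 4 -> dim_ge H 2 -> 0 < rho ->
  rho < 4 * (lambda + mu - lambda * mu) / (4 - lambda * mu) ->
  exists T U : H -> H,
    relaxed_FNE ip lambda T /\ relaxed_FNE ip mu U /\
    ~ relaxed_FNE ip rho (U \o T).
Proof.
move=> lambda0 mu0 lm4 /orthonormal_pair[e1 [e2 [e11 e22 e12]]] rho0.
have D0 := relaxation_gap_gt0 lambda0 mu0 lm4.
have E0 : 0 < 4 - lambda * mu by rewrite subr_gt0.
set nu := _ / _ => rho_nu.
have nu0 : 0 < nu by rewrite divr_gt0 ?mulr_gt0.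
have l0 : 0 < lambda^-1 by rewrite invr_gt0.
have k0 : 0 < mu^-1 by rewrite invr_gt0.
have c0 : 0 < lambda^-1 + mu^-1 - 1.
  by rewrite invrD_sub1E// divr_gt0 ?mulr_gt0.
have nuE : nu^-1 =
    (4 * lambda^-1 * mu^-1 - 1) / (4 * (lambda^-1 + mu^-1 - 1)).
  rewrite /nu; field.
  rewrite (gt_eqF lambda0) (gt_eqF mu0) (gt_eqF E0) /= andbT.
  by apply: lt0r_neq0; lra.
set l := lambda^-1 in l0 c0 nuE; set k := mu^-1 in k0 c0 nuE.
pose eps := rho^-1 - nu^-1.
have eps0 : 0 < eps by rewrite subr_gt0 ltf_pV2.
have ce0 : 0 < 16 * (l + k - 1) * eps by rewrite !mulr_gt0.
(* At this point the quotient exceeds its limit by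
   [1 / (4 (l + k - 1) (1 + 4 K ^ 2))], which has to be below [eps]. *)
pose K := 1 + (16 * (l + k - 1) * eps)^-1.
have K_large : 1 <= 16 * (l + k - 1) * eps * K ^+ 2.
  rewrite -ler_pdivrMl// mulr1 /K; set i := _^-1.
  have i0 : 0 < i by rewrite invr_gt0.
  by have := sqr_ge0 i; lra.
exists (plane_op e1 e2 l (K * (2 * l - 1))).
exists (plane_op e1 e2 k (K * (2 * k - 1))).
split; first exact: plane_op_relaxed_FNE.
split; first exact: plane_op_relaxed_FNE.
move=> /(plane_op_comp_ineq e11 e22 e12 l0 k0).
have -> : rho^-1 = eps + (4 * l * k - 1) / (4 * (l + k - 1)).
  by rewrite -nuE /eps subrK.
apply/negP; rewrite -ltNge -subr_gt0.
have -> : (eps + (4 * l * k - 1) / (4 * (l + k - 1))) *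
    ((l + k - 1) ^+ 2 + (K * (2 * l - 1) + K * (2 * k - 1)) ^+ 2) -
    ((l + k - 1) * (l * k - K * (2 * l - 1) * (K * (2 * k - 1))) +
     (K * (2 * l - 1) + K * (2 * k - 1)) *
     (l * (K * (2 * k - 1)) + k * (K * (2 * l - 1))))
  = (l + k - 1) * ((l + k - 1) * eps
      + (16 * (l + k - 1) * eps * K ^+ 2 - 1) / 4).
  by field; apply: lt0r_neq0; lra.
by rewrite mulr_gt0// ltr_wpDr ?mulr_gt0// divr_ge0// subr_ge0.
Qed.

(** The right-hand side of [plane_op_comp_ineq] is [(l + k - 1) l k] plus the
    quadratic form [l t ^ 2 + s t + k s ^ 2], which is indefinite for
    [4 l k < 1]: far out along the direction [s = - t / (2 k)], where it is
    negative, no relaxation parameter satisfies the inequality. *)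
Lemma exists_comp_not_RFNE_plane {lambda mu : R} :
  0 < lambda -> 0 < mu -> 4 < lambda * mu -> lambda * mu <= lambda + mu ->
  dim_ge H 2 ->
  exists T U : H -> H,
    relaxed_FNE ip lambda T /\ relaxed_FNE ip mu U /\ ~ RFNE ip (U \o T).
Proof.
move=> lambda0 mu0 lm4 lm /orthonormal_pair[e1 [e2 [e11 e22 e12]]].
have l0 : 0 < lambda^-1 by rewrite invr_gt0.
have k0 : 0 < mu^-1 by rewrite invr_gt0.
have c0 : 0 <= lambda^-1 + mu^-1 - 1.
  by rewrite invrD_sub1E// divr_ge0 ?subr_ge0// ltW// mulr_gt0.
have q0 : 0 < (1 - 4 * lambda^-1 * mu^-1) / (4 * mu^-1).
  rewrite divr_gt0 ?mulr_gt0// subr_gt0 -mulrA -invfM.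
  by rewrite mulrC ltr_pdivrMl ?mulr1 ?mulr_gt0// mulrC.
set l := lambda^-1 in l0 c0 q0; set k := mu^-1 in k0 c0 q0.
(* [- q * t ^ 2] is the value of the quadratic form at [s = - t / (2 k)]. *)
set q := _ / _ in q0.
pose K := 1 + (l + k - 1) * l * k / q.
have K_large : (l + k - 1) * l * k < q * K ^+ 2.
  rewrite -ltr_pdivrMl// mulrC /K; set i := _ / q.
  have i0 : 0 <= i.
    by apply: divr_ge0; rewrite ?(ltW q0)// !mulr_ge0 ?(ltW l0) ?(ltW k0).
  by have := sqr_ge0 i; lra.
exists (plane_op e1 e2 l (- (K / (2 * k)))), (plane_op e1 e2 k K).
split; first exact: plane_op_relaxed_FNE.
split; first exact: plane_op_relaxed_FNE.
move=> [rho] /[dup] [[rho0 _]].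
move=> /(plane_op_comp_ineq e11 e22 e12 l0 k0).
apply/negP; rewrite -ltNge.
apply: (@lt_le_trans _ _ 0).
  have -> : (l + k - 1) * (l * k - - (K / (2 * k)) * K) +
      (- (K / (2 * k)) + K) * (l * K + k * - (K / (2 * k)))
    = (l + k - 1) * l * k - q * K ^+ 2.
    by rewrite /q; field; rewrite (gt_eqF k0).
  by rewrite subr_lt0.
by rewrite mulr_ge0 ?invr_ge0 ?addr_ge0 ?sqr_ge0// ltW.
Qed.

(** The composition of the homotheties of ratios [1 - lambda] and [1 - mu] is a
    homothety of ratio greater than [1], which pushes points away from each other. *)
Lemma exists_comp_not_RFNE_line {lambda mu : R} :
  (exists x : H, x != 0) ->
  0 < lambda -> 0 < mu -> lambda + mu < lambda * mu ->
  exists T U : H -> H,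
    relaxed_FNE ip lambda T /\ relaxed_FNE ip mu U /\ ~ RFNE ip (U \o T).
Proof.
move=> [x x0] lambda0 mu0 lm.
exists (fun z => (1 - lambda) *: z), (fun z => (1 - mu) *: z).
split; first by apply: homothety_relaxed_FNE; rewrite // lexx ltW.
split; first by apply: homothety_relaxed_FNE; rewrite // lexx ltW.
move=> [rho] /[dup] [[rho0 _]] /(relaxed_FNEP rho0)/(_ x 0).
rewrite /= !scaler0 !subr0 sub0r scalerA.
have -> : ((1 - mu) * (1 - lambda)) *: x - x
    = (lambda * mu - (lambda + mu)) *: x.
  by rewrite -[X in _ - X]scale1r -scalerBl; congr (_ *: _); ring.
apply/negP; rewrite -ltNge ipNl ipZr -ip_norm.
apply: (@lt_le_trans _ _ 0).
  by rewrite oppr_lt0 mulr_gt0 ?subr_gt0// exprn_gt0// normr_gt0.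
by rewrite mulr_ge0 ?sqr_ge0// invr_ge0 ltW.
Qed.

(** Two homotheties of ratios [1 - lambda] and [1 - tau] are inverse to each
    other when [lambda^-1 + tau^-1 = 1], and this [tau] is at most [mu].  The
    composition then fixes every point, while [T] fixes the origin alone. *)
Lemma exists_Fix_comp_neq {lambda mu : R} :
  (exists x : H, x != 0) ->
  0 < lambda -> 0 < mu -> lambda + mu <= lambda * mu ->
  exists T U : H -> H,
    relaxed_FNE ip lambda T /\ relaxed_FNE ip mu U /\
    Fix (U \o T) <> Fix T `&` Fix U /\ Fix T `&` Fix U !=set0.
Proof.
move=> [x x0] lambda0 mu0 lm.
have k0 : 0 < mu^-1 by rewrite invr_gt0.
have lk1 : lambda^-1 + mu^-1 - 1 <= 0.
  by rewrite invrD_sub1E// pmulr_lle0 ?subr_le0// invr_gt0 mulr_gt0.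
have l1 : 0 < 1 - lambda^-1 by lra.
have lambda1 : 1 < lambda by move: l1; rewrite subr_gt0 invf_lt1.
pose tau := (1 - lambda^-1)^-1.
exists (fun z => (1 - lambda) *: z), (fun z => (1 - tau) *: z).
split; first by apply: homothety_relaxed_FNE; rewrite // lexx ltW.
split.
  apply: homothety_relaxed_FNE; rewrite // invr_ge0 ltW//=.
  by rewrite -[leRHS]invrK lef_pV2 ?posrE//; lra.
split; last by exists 0; rewrite /Fix; split; rewrite /= scaler0.
move=> FixE.
have : Fix ((fun z => (1 - tau) *: z) \o (fun z => (1 - lambda) *: z)) x.
  rewrite /Fix /= scalerA -[RHS]scale1r; congr (_ *: _).
  rewrite /tau; field; rewrite (gt_eqF lambda0) /=.
  by apply: lt0r_neq0; lra.
rewrite FixE => -[/eqP + _].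
rewrite -subr_eq0 -[X in _ - X]scale1r -scalerBl addrAC subrr sub0r.
by rewrite scaler_eq0 oppr_eq0 (gt_eqF lambda0) (negbTE x0).
Qed.

End InnerProduct.

Theorem theorem3p6 (R : realType) (H : completeNormedModType R)
    (ip : {dot H for idfun}) (ip_norm : induces_norm ip)
    (H_nontrivial : exists x : H, x != 0)
    (lambda mu : R) (lambda_gt0 : 0 < lambda) (mu_gt0 : 0 < mu)
    (T U : H -> H)
    (T_RFNE : relaxed_FNE ip lambda T) (U_RFNE : relaxed_FNE ip mu U) :
  (* (i) *)
  (forall (x y : H) (nu : R), nu != 0 ->
     let a1 := T x - x in
     let a2 := T y - y in
     let b1 := (U \o T) x - T x in
     let b2 := (U \o T) y - T y in
     let d := ((U \o T) x - x) - ((U \o T) y - y) in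
     (lambda^-1 - nu^-1) * `|a1 - a2| ^+ 2
       + (mu^-1 - nu^-1) * `|b1 - b2| ^+ 2
       + (1 - 2 / nu) * ip (a1 - a2) (b1 - b2)
     <= ip (y - x) d - nu^-1 * `|d| ^+ 2)
  /\
  (* (ii) *)
  (lambda * mu < 4 ->
     let nu_star := 4 * (lambda + mu - lambda * mu) / (4 - lambda * mu) in
     relaxed_FNE ip nu_star (U \o T)
     /\ demi_closedness_principle ip (U \o T)
     /\ (dim_ge H 2 ->
         forall rho : R, 0 < rho -> rho < nu_star ->
         exists T' U' : H -> H,
           relaxed_FNE ip lambda T' /\ relaxed_FNE ip mu U' /\
           ~ relaxed_FNE ip rho (U' \o T')))
  /\
  (* (iii) *)
  (lambda * mu < lambda + mu -> Fix T `&` Fix U !=set0 ->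
     Fix (U \o T) = Fix T `&` Fix U)
  /\
  (* (iv) *)
  (4 < lambda * mu ->
     (lambda * mu <= lambda + mu /\ dim_ge H 2) \/ lambda + mu < lambda * mu ->
     exists T' U' : H -> H,
       relaxed_FNE ip lambda T' /\ relaxed_FNE ip mu U' /\
       ~ RFNE ip (U' \o T'))
  /\
  (* (v) *)
  (lambda + mu <= lambda * mu ->
     exists T' U' : H -> H,
       relaxed_FNE ip lambda T' /\ relaxed_FNE ip mu U' /\
       Fix (U' \o T') <> Fix T' `&` Fix U' /\
       Fix T' `&` Fix U' !=set0).
Proof.
split.
  move=> x y nu _; exact: (relaxed_residual_comp_ge ip_norm nu^-1 T_RFNE U_RFNE
    x y _ _ _ erefl erefl erefl).
split.
  move=> lm4 nu_star.
  have UT_RFNE : relaxed_FNE ip nu_star (U \o T).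
    exact: (relaxed_FNE_comp ip_norm).
  split=> //; split; first exact: (relaxed_FNE_demiclosed ip_norm) UT_RFNE.
  by move=> dim2 rho rho0 rho_lt; exact: (relaxed_FNE_comp_optimal ip_norm).
split; first exact: (Fix_comp ip_norm T_RFNE U_RFNE).
split; last exact: (exists_Fix_comp_neq ip_norm).
move=> lm4 [[lm dim2]|lm].
  exact: (exists_comp_not_RFNE_plane ip_norm).
exact: (exists_comp_not_RFNE_line ip_norm).
Qed.
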